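(* Let $\mathbf{X}$ and $\mathbf{Y}$ be disjoint subsets of the node set $\mathbf{V}$ of a DAG $\mathcal{D}$ such that $\mathbf{Y}\subseteq\mathrm{de}(\mathbf{X},\mathcal{D})$. Then $\mathbf{O}(\mathbf{X},\mathbf{Y},\mathcal{D})=\mathbf{O}^*(\mathbf{X},\mathbf{Y},\mathcal{D})$.
   Context: A path is a sequence of distinct nodes together with edges joining consecutive nodes. A path from $\mathbf{X}$ to $\mathbf{Y}$ has first node in $\mathbf{X}$ and last node in $\mathbf{Y}$; it is proper if only its first node is in $\mathbf{X}$, and causal (directed) if all its edges point towards the last node. $\mathrm{de}(V,\mathcal{D})$ is the set of descendants of $V$ (including $V$), $\mathrm{pa}(V,\mathcal{G})=\{W: W\rightarrow V\text{ in }\mathcal{G}\}$; for node sets take unions. $\mathrm{cn}(\mathbf{X},\mathbf{Y},\mathcal{D})$ is the set of nodes on proper causal paths from $\mathbf{X}$ to $\mathbf{Y}$, excluding nodes in $\mathbf{X}$. $\mathrm{forb}(\mathbf{X},\mathbf{Y},\mathcal{D})=\mathrm{de}(\mathrm{cn}(\mathbf{X},\mathbf{Y},\mathcal{D}),\mathcal{D})\cup\mathbf{X}$. Latent projection. For a DAG $\mathcal{D}$ with node set $\mathbf{W}\cup\mathbf{L}$, $\mathbf{W}\cap\mathbf{L}=\emptyset$, the latent projection $\mathcal{D}(\mathbf{W})$ has node set $\mathbf{W}$ and, for distinct $W_i,W_j\in\mathbf{W}$: (1) an edge $W_i\rightarrow W_j$ iff $\mathcal{D}$ contains a directed path $W_i\rightarrow\dots\rightarrow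 W_j$ on which all non-endpoint nodes are in $\mathbf{L}$; (2) an edge $W_i\leftrightarrow W_j$ iff $\mathcal{D}$ contains a path, with at least one non-endpoint node, of the form $W_i\leftarrow\dots\rightarrow W_j$ on which all non-endpoint nodes are non-colliders (i.e. not both adjoining path edges point into the node) and in $\mathbf{L}$. Forbidden projection: $\mathcal{D}^{\mathbf{XY}}=\mathcal{D}((\mathbf{V}\setminus\mathrm{forb}(\mathbf{X},\mathbf{Y},\mathcal{D}))\cup\mathbf{X}\cup\mathbf{Y})$. $\mathbf{O}$-set: $\mathbf{O}(\mathbf{X},\mathbf{Y},\mathcal{D})=\mathrm{pa}(\mathrm{cn}(\mathbf{X},\mathbf{Y},\mathcal{D}),\mathcal{D})\setminus\mathrm{forb}(\mathbf{X},\mathbf{Y},\mathcal{D})$. $\mathbf{O}^*$-set: $\mathbf{O}^*(\mathbf{X},\mathbf{Y},\mathcal{D})=\mathrm{pa}(\mathbf{Y},\mathcal{D}^{\mathbf{XY}})\setminus(\mathbf{X}\cup\mathbf{Y})$. *)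

(* Defs.v *)
From mathcomp Require Import all_boot.
From mathcomp Require Import boolp classical_sets.

Set Implicit Arguments.
Unset Strict Implicit.
Unset Printing Implicit Defensive.

Local Open Scope classical_set_scope.

(* The node set of the DAG is the whole finite type V. *)
Record dag (V : finType) := Dag {
  edge : rel V;
  dag_acyclic : forall c : seq V, cycle edge c -> c = [::] }.

Record mixed_graph (V : finType) := MixedGraph {
  nodes : set V;
  arrow : V -> V -> Prop;
  biarrow : V -> V -> Prop;
  arrow_nodes : forall u v, arrow u v -> nodes u /\ nodes v;
  biarrow_nodes : forall u v, biarrow u v -> nodes u /\ nodes v }.

Program Definition mixed_graph_of_dag (V : finType) (D : dag V) :
    mixed_graph V :=
  {| nodes := setT;
     arrow := fun u v => edge D u v;
     biarrow := fun _ _ => False |}.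

Coercion mixed_graph_of_dag : dag >-> mixed_graph.

Section Graphs.
Variable V : finType.
Implicit Types (D : dag V) (X Y W A : set V).

Definition pa A (G : mixed_graph V) : set V :=
  [set w | exists2 v, A v & arrow G w v].

Definition de A D : set V :=
  [set w | exists2 v, A v & connect (edge D) v w].

(* A DAG has at most one edge between two nodes, so a path in it is determined
   by its sequence of nodes. *)
Definition is_path D (s : seq V) : bool :=
  uniq s && sorted [rel u v | edge D u v || edge D v u] s.

Definition is_causal_path D (s : seq V) : bool :=
  is_path D s && sorted (edge D) s.

Definition path_from_to X Y D (x : V) (p : seq V) : Prop :=
  [/\ is_path D (x :: p), X x & Y (last x p)].

Definition proper X (x : V) (p : seq V) : Prop :=
  forall v, v \in p -> ~ X v.

Definition cn X Y D : set V :=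
  [set w | exists x p, [/\ path_from_to X Y D x p, proper X x p,
                           is_causal_path D (x :: p) & w \in x :: p]] `\` X.

Definition forb X Y D : set V := de (cn X Y D) D `|` X.

Definition collider D (u v w : V) : bool := edge D u v && edge D w v.

Definition latent_arrow D W (u v : V) : Prop :=
  [/\ W u, W v, u <> v &
    exists q, is_causal_path D (u :: rcons q v) /\
              forall z, z \in q -> (~` W) z].

(* The path is u, z, ..., v with interior z :: q; the edges at its two ends
   point into u and v. *)
Definition latent_biarrow D W (u v : V) : Prop :=
  [/\ W u, W v, u <> v &
    exists z q,
      let s := u :: rcons (z :: q) v in
      [/\ is_path D s,
          edge D z u /\ edge D (last z q) v,
          forall a b c, infix [:: a; b; c] s -> ~~ collider D a b c &
          forall t, t \in z :: q -> (~` W) t]].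

(* D(W), the latent nodes being those outside W. *)
Program Definition latent_projection D W : mixed_graph V :=
  {| nodes := W;
     arrow := latent_arrow D W;
     biarrow := latent_biarrow D W |}.
Next Obligation. by case: H. Qed.
Next Obligation. by case: H. Qed.

Definition forbidden_projection X Y D : mixed_graph V :=
  latent_projection D ((~` forb X Y D) `|` X `|` Y).

Definition Oset X Y D : set V := pa (cn X Y D) D `\` forb X Y D.

Definition Ostar X Y D : set V :=
  pa Y (forbidden_projection X Y D) `\` (X `|` Y).

End Graphs.

(* Main.v *)
Require Import Defs.
From mathcomp Require Import all_boot.
From mathcomp Require Import boolp classical_sets.

(** Both sets consist of nodes outside forb(X, Y) that have an edge into a
    directed route to Y.  The bridge is a local description of cn(X, Y), lemma
    [cnP]: a node [c] lies on a proper causal path iff it descends from X and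
    some directed walk from [c] to Y avoids X.  The right-to-left implication
    cuts a walk from X to [c] at its last visit to X and continues to Y; no
    node repeats because D is acyclic.  In particular Y is contained in
    cn(X, Y), since Y consists of descendants of X and is disjoint from X.

    The latent nodes of the forbidden projection are the forbidden nodes outside
    X and Y.  If [w -> c] with [c] in cn(X, Y), the walk from [c] to Y
    stays in cn(X, Y); stopped at its first visit to Y, all its earlier nodes
    are latent, so it projects to an edge from [w] into Y.  Conversely, suppose
    that an edge from [w] into Y is projected from [w -> c -> ... -> y].
    The node [c] is [y] or a latent node; both are descendants of X from
    which the rest of the path reaches Y outside X, so [c] is in cn(X, Y). *)

Local Open Scope classical_set_scope.

Section ForbiddenProjection.
Variables (V : finType) (D : dag V).
Implicit Types (X Y A : set V) (c v w : V) (p s : seq V).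

Lemma sorted_edge_uniq s : sorted (edge D) s -> uniq s.
Proof.
elim: s => //= v s IHs vs; rewrite (IHs (path_sorted vs)) andbT.
apply/negP => v_s; case/splitPr: v_s vs => p1 p2.
rewrite cat_path /= => /and3P[vp1 p1v _].
suff: v :: p1 = [::] by [].
by apply: (@dag_acyclic _ D); rewrite /= rcons_path vp1 p1v.
Qed.

Lemma sorted_edge_causal s : sorted (edge D) s -> is_causal_path D s.
Proof.
move=> sD; rewrite /is_causal_path /is_path sD (sorted_edge_uniq _ sD) andbT /=.
by apply: sub_sorted sD => u v /= ->.
Qed.

Lemma walk_from_last_visit X v p : X v -> path (edge D) v p ->
  exists x s, [/\ X x, path (edge D) x s, last x s = last v p &
                  forall z, z \in s -> ~ X z].
Proof.
move=> Xv; elim/last_ind: p => [|p z IHp]; first by exists v, [::].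
rewrite rcons_path last_rcons => /andP[/IHp[x [s [Xx xs xsE sX]]] pz].
have [Xz|nXz] := pselect (X z); first by exists z, [::].
exists x, (rcons s z); split=> //.
- by rewrite rcons_path xs xsE.
- by rewrite last_rcons.
- by move=> t; rewrite mem_rcons in_cons => /predU1P[->//|/sX].
Qed.

(** The start [c] is written as [head y q] because [q] is empty, and
    [c] is [y] itself, when [c] already lies in Y. *)
Lemma walk_to_first_visit Y c p : path (edge D) c p -> Y (last c p) ->
  exists q y, [/\ Y y, sorted (edge D) (rcons q y), c = head y q,
                  {subset q <= c :: p} & forall z, z \in q -> ~ Y z].
Proof.
elim: p c => [|b p IHp] c /=; first by move=> _ Yc; exists [::], c.
have [Yc|nYc] := pselect (Y c); first by exists [::], c.
move=> /andP[cb bp] Yl; have [q [y [Yy qy bE qp qY]]] := IHp _ bp Yl.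
exists (c :: q), y; split=> //=.
- by move: qy cb; rewrite bE; case: (q) => /= [_ ->|a r -> ->].
- move=> z; rewrite in_cons => /predU1P[->|/qp zp]; first exact: mem_head.
  by rewrite in_cons zp orbT.
- by move=> z; rewrite in_cons => /predU1P[->//|/qY].
Qed.

(** Membership in cn(X, Y) is reduced to separate conditions before and after
    [c], which no longer mention repetitions or the first visit to X. *)
Lemma cnP X Y c : cn X Y D c <->
  de X D c /\ exists p, [/\ path (edge D) c p, Y (last c p) &
                            forall z, z \in c :: p -> ~ X z].
Proof.
split=> [[[x [p [[_ Xx Yl] pX /andP[_ /= xp] cp]]] nXc]|].
- have {}cp : c \in p.
    by move: cp; rewrite in_cons => /predU1P[cx|//]; case: nXc; rewrite cx.
  case/splitPr: cp xp pX Yl => p1 p2; rewrite cat_path last_cat /=.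
  move=> /and3P[xp1 p1c cp2] pX Yl; split.
    exists x => //; apply/connectP; exists (rcons p1 c); last by rewrite last_rcons.
    by rewrite rcons_path xp1.
  by exists p2; split=> // z zp2; apply: pX; rewrite mem_cat zp2 orbT.
- move=> [[a Xa /connectP[r ar cE]] [p [cp Yl pX]]].
  have [x [s [Xx xs xsE sX]]] := walk_from_last_visit _ _ _ Xa ar.
  have {}xsE : last x s = c by rewrite xsE cE.
  split; last by apply: pX; rewrite mem_head.
  have xspD : is_causal_path D (x :: s ++ p).
    by apply: sorted_edge_causal; rewrite /= cat_path xs xsE.
  exists x, (s ++ p); split=> //.
  + by split=> //; [case/andP: xspD | rewrite last_cat xsE].
  + move=> z; rewrite mem_cat => /orP[/sX//|zp].
    by apply: pX; rewrite in_cons zp orbT.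
  + by rewrite -xsE -cat_cons mem_cat mem_last.
Qed.

Lemma de_trans A v w : de A D v -> connect (edge D) v w -> de A D w.
Proof. by move=> [a Aa av] vw; exists a => //; apply: connect_trans vw. Qed.

Lemma forb_de X Y : forb X Y D `<=` de X D.
Proof.
move=> w [[c /cnP[cX _]]|Xw]; first exact: de_trans.
by exists w.
Qed.

Lemma cn_forb X Y : cn X Y D `<=` forb X Y D.
Proof. by move=> c cc; left; exists c. Qed.

Lemma cn_target X Y : X `&` Y = set0 -> Y `<=` de X D -> Y `<=` cn X Y D.
Proof.
move=> disjXY Yde y Yy; apply/cnP; split; first exact: Yde.
exists [::]; split=> // z; rewrite inE => /eqP-> Xy.
by have : (X `&` Y) y by []; rewrite disjXY.
Qed.

(** Hence a walk that meets Y at its end and avoids X cannot leave cn(X, Y) once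
    it starts below X: the tail from any of its nodes is again such a walk. *)
Lemma cn_walk X Y c p : de X D c -> path (edge D) c p -> Y (last c p) ->
  (forall z, z \in c :: p -> ~ X z) -> forall z, z \in c :: p -> cn X Y D z.
Proof.
move=> cX cp Yl pX z; rewrite in_cons => /predU1P[->|zp].
  by apply/cnP; split=> //; exists p.
case/splitPr: zp cp Yl pX => p1 p2; rewrite cat_path last_cat /=.
move=> /and3P[cp1 p1z zp2] Yl pX; apply/cnP; split; last first.
  by exists p2; split=> // t tp2; apply: pX; rewrite in_cons mem_cat tp2 !orbT.
apply: de_trans cX _; apply/connectP; exists (rcons p1 z).
  by rewrite rcons_path cp1.
by rewrite last_rcons.
Qed.

End ForbiddenProjection.

Theorem proposition10 (V : finType) (D : dag V) (X Y : set V)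
    (disjXY : X `&` Y = set0) (Yde : Y `<=` de X D) :
  Oset X Y D = Ostar X Y D.
Proof.
have Ycn := cn_target _ _ _ _ disjXY Yde.
apply/seteqP; split=> w.
- move=> [[c /cnP[cX [p [cp Yl pX]]] /= wc] nfw].
  have nYw : ~ Y w by move=> /Ycn/cn_forb.
  have nXw : ~ X w by move=> Xw; apply: nfw; right.
  have [q [y [Yy qy cE qp qY]]] := walk_to_first_visit _ _ _ _ _ cp Yl.
  split; last by case.
  exists y => //; split.
  + by left; left.
  + by right.
  + by move=> wy; apply: nYw; rewrite wy.
  exists q; split.
    apply: sorted_edge_causal; move: qy wc; rewrite cE.
    by case: (q) => /= [_ ->|a r -> ->].
  move=> z zq [[|Xz]|Yz]; last exact: qY zq Yz.
    by apply; apply: cn_forb; apply: cn_walk (qp _ zq).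
  exact: pX (qp _ zq) Xz.
- move=> [[y Yy [Ww _ _ [q [/andP[_ wqy] qL]]]] nXYw].
  have nfw : ~ forb X Y D w.
    by case: Ww => [[]|] // ?; case: nXYw; [left|right].
  have nXqy z : z \in rcons q y -> ~ X z.
    rewrite mem_rcons in_cons => /predU1P[->|/qL nWz] Xz; last first.
      by apply: nWz; left; right.
    by have [] := Ycn _ Yy.
  split=> //.
  (* The successor of w is y itself for empty q, and is latent otherwise. *)
  case: q wqy qL nXqy => [/= /andP[wy _] _ _|c q /= /andP[wc cqy] qL nXqy].
    by exists y => //; apply: Ycn.
  exists c => //; apply/cnP; split; last first.
    by exists (rcons q y); rewrite last_rcons.
  apply: (@forb_de _ _ _ Y); apply: contrapT => nfc.
  by apply: (qL c); [exact: mem_head | left; left].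
Qed.
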